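(* For every integer $n\ge 0$, \[ \overline{p}_o(n)=\sum_{k=-\infty}^{\infty}(-1)^k\,\overline{p}(n-2k^2). \]
   Context: An overpartition of $n$ is a partition of $n$ in which the first occurrence of each part size may be overlined. $\overline{p}(n)$ is the number of overpartitions of $n$, with $\sum_{n\ge0}\overline{p}(n)q^n=\frac{(-q;q)_\infty}{(q;q)_\infty}$; $\overline{p}_o(n)$ is the number of overpartitions of $n$ into odd parts, with $\sum_{n\ge0}\overline{p}_o(n)q^n=\frac{(-q;q^2)_\infty}{(q;q^2)_\infty}$, where $(a;q)_\infty=\prod_{k\ge1}(1-aq^{k-1})$. Convention: $\overline{p}(x)=0$ whenever $x$ is not a nonnegative integer. *)

(* Defs.v *)
From mathcomp Require Import all_boot all_order all_algebra.
From mathcomp Require Import boolp classical_sets functions cardinality fsbigop.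

Set Implicit Arguments.
Unset Strict Implicit.
Unset Printing Implicit Defensive.

Import Order.TTheory GRing.Theory Num.Theory.

Definition is_partition (n : nat) (s : seq nat) : bool :=
  [&& sorted geq s, all (leq 1) s & sumn s == n].

(* A part is a pair (size, overlined?), listed by nonincreasing size. *)
Definition only_first_overlined (s : seq (nat * bool)) : bool :=
  all (fun i => nth false (unzip2 s) i ==>
                (nth 0 (unzip1 s) i \notin take i (unzip1 s)))
      (iota 0 (size s)).

Definition is_overpartition (n : nat) (s : seq (nat * bool)) : bool :=
  is_partition n (unzip1 s) && only_first_overlined s.

(* A partition of n has at most n parts, each at most n, so the overpartitions
   of n can be counted inside a finite type; see overpartition_bounded. *)
Definition bounded_parts (n : nat) : finType := n.-bseq ('I_n.+1 * bool)%type.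

Definition parts (n : nat) (t : bounded_parts n) : seq (nat * bool) :=
  [seq (val p.1, p.2) | p <- bseqval t].

Definition overp (n : nat) : nat :=
  #|[set t : bounded_parts n | is_overpartition n (parts t)]|.

Definition overp_odd (n : nat) : nat :=
  #|[set t : bounded_parts n |
      is_overpartition n (parts t) && all odd (unzip1 (parts t))]|.

Definition overpz (x : int) : nat := if x is Posz m then overp m else 0.

Lemma overpartition_bounded (n : nat) (s : seq (nat * bool)) :
  is_overpartition n s -> exists t : bounded_parts n, parts t = s.
Proof.
case/andP => /and3P[_ pos /eqP sum_s] _.
have size_s : size s <= n.
  rewrite -sum_s; elim: s pos {sum_s} => //= p s IHs /andP[p_gt0 /IHs le_s].
  by rewrite -add1n leq_add.
have le_n p : p \in s -> p.1 <= n.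
  rewrite -sum_s => s_p; have: p.1 \in unzip1 s by apply: map_f.
  elim: (unzip1 s) => //= a l IHl; rewrite inE => /orP[/eqP->|/IHl le_l].
    exact: leq_addr.
  exact: leq_trans le_l (leq_addl _ _).
pose u := [seq (inord p.1 : 'I_n.+1, p.2) | p <- s].
have size_u : size u <= n by rewrite size_map.
exists (Bseq size_u); rewrite /parts /= -map_comp -[RHS]map_id.
by apply/eq_in_map => -[a b] /le_n /= le_a; rewrite inordK.
Qed.

Lemma parts_inj (n : nat) : injective (@parts n).
Proof.
move=> t1 t2 eq_t; apply: val_inj; apply: inj_map eq_t.
by move=> [a b] [c d] /= [/val_inj-> ->].
Qed.

Local Open Scope ring_scope.
Local Open Scope classical_set_scope.

(* The unrestricted sum over int is the genuine one, not the default value 0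
   that fsbigop gives to a family with infinite support. *)
Lemma overpz_finite_support (n : nat) (f : int -> int) :
  finite_set ([set: int] `&`
    (fun k : int => f k * (overpz (n%:Z - 2 * k ^+ 2))%:Z) @^-1` [set~ 0]).
Proof.
pose bnd : seq int := [seq i%:Z - n%:Z | i <- iota 0 n.*2.+1].
apply: (@sub_finite_set _ _ [set` bnd]); last exact: finite_seq.
move=> k [_ /= nz]; have: `|k| <= n%:Z.
  rewrite leNgt; apply/negP => lt_nk; apply: nz.
  suff: n%:Z - 2 * k ^+ 2 < 0 by case: (_ - _) => // m _; rewrite mulr0.
  rewrite subr_lt0 (lt_le_trans lt_nk) // -real_normK ?num_real //.
  have k_ge1 : 1 <= `|k| by rewrite -gtz0_ge1 (le_lt_trans _ lt_nk).
  rewrite expr2 mulrA ler_peMl // (le_trans k_ge1) // ler_peMl //.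
rewrite ler_norml => /andP[le_k ge_k].
apply/mapP; exists (absz (k + n%:Z)%R); last first.
  by rewrite gez0_abs ?addrK // -lerBlDr sub0r.
have k_ge0 : 0 <= k + n%:Z by rewrite -lerBlDr sub0r.
by rewrite mem_iota add0n leq0n ltnS -lez_nat gez0_abs // -addnn PoszD lerD2r.
Qed.

(* Main.v *)
Require Import Defs.
From mathcomp Require Import all_boot all_order all_algebra.
From mathcomp Require Import boolp classical_sets functions cardinality fsbigop.
From mathcomp Require Import zify ring.

(** An overpartition is a list of items (size, overlined?), nonincreasing for
    the order (p, true) > (p, false) > (p - 1, true) > ..., in which only
    non-overlined items repeat. Hence an overlined p contributes the factor
    1 + X^p to the generating function and a plain p contributes 1/(1 - X^p), so
    that the claim reduces to Gauss's identity at q = X^2: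
      sum_k (-1)^k q^(k^2) = prod_i (1 - q^i)/(1 + q^i).
    The latter is the limit of the finite Jacobi triple product at z = 1,
      sum_k (-1)^k q^(k^2) [2n, n+k]_(q^2) = prod_(i < n) (1 - q^(2i+1))^2,
    which is an instance of the q-binomial theorem. Power series are replaced by
    polynomials modulo a power of X, with all infinite products cut off. *)

Set Implicit Arguments.
Unset Strict Implicit.
Unset Printing Implicit Defensive.

Import Order.TTheory GRing.Theory Num.Theory.

Local Open Scope ring_scope.

(** * The q-binomial theorem and the finite Jacobi identity *)

Fixpoint qbinom (R : comNzRingType) (Q : R) (m k : nat) : R :=
  match m, k with
  | _, 0 => 1
  | 0, _.+1 => 0
  | m'.+1, k'.+1 => qbinom Q m' k' + Q ^+ k * qbinom Q m' k
  end.
Arguments qbinom : simpl never.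

Definition qpoch (R : comNzRingType) (Q : R) (n : nat) : R :=
  \prod_(i < n) (1 - Q ^+ i.+1).

Section QBinomial.
Variables (R : comNzRingType) (Q : R).

Lemma qbinom0 m : qbinom Q m 0 = 1.
Proof. by case: m. Qed.

Lemma qbinomS m k :
  qbinom Q m.+1 k.+1 = qbinom Q m k + Q ^+ k.+1 * qbinom Q m k.+1.
Proof. by []. Qed.

Lemma qbinom_small m k : (m < k)%N -> qbinom Q m k = 0.
Proof.
elim: m k => [|m IHm] [|k] // lt_mk.
by rewrite qbinomS !IHm ?mulr0 ?addr0 // ltnW.
Qed.

Lemma qpochS n : qpoch Q n.+1 = qpoch Q n * (1 - Q ^+ n.+1).
Proof. exact: big_ord_recr. Qed.

(** The quotient formula with denominators cleared. Pascal's rule lowers either [m] or [k], hence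
    the induction on a bound for [m + k]. *)
Lemma qbinom_qpoch m k :
  qbinom Q (m + k) k * qpoch Q k * qpoch Q m = qpoch Q (m + k).
Proof.
have qpoch0 : qpoch Q 0 = 1 by rewrite /qpoch big_ord0.
have [s le_s] := ubnP (m + k)%N; elim: s m k le_s => // s IHs [|m] [|k] lt_s.
- by rewrite qpoch0 !mulr1.
- have -> : qbinom Q k.+1 k.+1 = 1.
    elim: (k.+1) => // i IHi.
    by rewrite qbinomS IHi qbinom_small // mulr0 addr0.
  by rewrite qpoch0 mul1r mulr1.
- by rewrite addn0 qbinom0 qpoch0 !mul1r.
rewrite addSn addnS qbinomS [qpoch Q (m + k).+2]qpochS.
have IH1 := IHs m.+1 k ltac:(lia); have IH2 := IHs m k.+1 ltac:(lia).
rewrite addSn in IH1; rewrite addnS in IH2.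
(* This splits 1 - Q^(m+k+2) as (1 - Q^(k+1)) + Q^(k+1) (1 - Q^(m+1)), one summand per Pascal
   term. *)
transitivity ((1 - Q ^+ k.+1) * qpoch Q (m + k).+1
  + Q ^+ k.+1 * (1 - Q ^+ m.+1) * qpoch Q (m + k).+1).
  rewrite -{1}IH1 -IH2 !qpochS; ring.
have -> : Q ^+ (m + k).+2 = Q ^+ k.+1 * Q ^+ m.+1.
  by rewrite -exprD; congr (_ ^+ _); lia.
ring.
Qed.

(** Splitting off the factor i = 0 leaves the product for [m] at x Q; Pascal's rule recombines the
    two copies of its expansion. *)
Lemma rothe m (x y : R) :
  \prod_(i < m) (y + x * Q ^+ i) =
  \sum_(k < m.+1) Q ^+ 'C(k, 2) * qbinom Q m k * x ^+ k * y ^+ (m - k).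
Proof.
elim: m x => [|m IHm] x.
  by rewrite big_ord0 big_ord1 bin0n /= !mul1r.
pose S := \sum_(k < m.+1)
  Q ^+ 'C(k.+1, 2) * qbinom Q m k * x ^+ k * y ^+ (m - k).
rewrite big_ord_recl /= mulr1; under eq_bigr do rewrite exprS mulrA.
rewrite IHm.
have -> : \sum_(k < m.+1)
    Q ^+ 'C(k, 2) * qbinom Q m k * (x * Q) ^+ k * y ^+ (m - k) = S.
  by apply: eq_bigr => k _; rewrite exprMn binS bin1 exprD; ring.
rewrite mulrDl [RHS]big_ord_recl /= bin0n subn0 qbinom0 !mul1r.
under [X in _ = _ + X]eq_bigr => k _.
  rewrite /bump /= add1n subSS qbinomS mulrDr !mulrDl.
  have -> : Q ^+ 'C(k.+1, 2) * qbinom Q m k * x ^+ k.+1 * y ^+ (m - k) =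
    x * (Q ^+ 'C(k.+1, 2) * qbinom Q m k * x ^+ k * y ^+ (m - k)).
    by rewrite exprS; ring.
  over.
rewrite big_split /= -mulr_sumr -/S addrCA addrC; congr (_ + _).
rewrite big_ord_recr /= qbinom_small ?ltnSn // !(mulr0, mul0r) addr0.
rewrite /S big_ord_recl /= subn0 qbinom0 mulr1 !mul1r mulrDr -exprS.
congr (_ + _).
rewrite mulr_sumr; apply: eq_bigr => k _; rewrite /bump /= add1n.
have -> : (m - k = (m - k.+1).+1)%N by case: k => k /=; lia.
by rewrite [in LHS]binS bin1 exprD [y ^+ _.+1]exprS; ring.
Qed.

End QBinomial.

(* [subn] truncates, so at most one summand is nonzero. *)
Definition absdiff (n k : nat) : nat := (n - k) + (k - n).

Lemma prod_qeven (R : comNzRingType) (q : R) n :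
  \prod_(i < n) (q ^+ 2) ^+ i = q ^+ (n * n.-1).
Proof.
elim: n => [|n IHn]; first by rewrite big_ord0.
rewrite big_ord_recr /= IHn -exprM -exprD; congr (_ ^+ _).
by case: n {IHn} => *; nia.
Qed.

(** Completing the square: at x = -1, y = q^(2n-1), Q = q^2, the k-th term of [rothe] has exponent
    (n - k)^2 up to a constant. *)
Lemma jacobi_exponent n k : (k <= n.*2)%N ->
  (n * n.-1 + n * n.*2.-1 + absdiff n k ^ 2
   = k * k.-1 + n.*2.-1 * (n.*2 - k))%N.
Proof.
rewrite /absdiff; have [le_kn | /ltnW le_nk] := leqP k n => le_k.
  have -> : (k - n = 0)%N by lia.
  have [d ->] : exists d, n = (k + d)%N by exists (n - k)%N; lia.
  rewrite addKn addn0 (_ : (k + d).*2 - k = k + d + d)%N; last lia.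
  by case: k {le_kn le_k} => [|k]; case: d => [|d]; nia.
have -> : (n - k = 0)%N by lia.
have [d nd] : exists d, n = (k - n + d)%N by exists (n - (k - n))%N; lia.
have [e ke] : exists e, k = (n + e)%N by exists (k - n)%N; lia.
rewrite ke addKn in nd le_nk le_k *; rewrite nd.
rewrite (_ : (e + d).*2 - (e + d + e) = d)%N; last lia.
by case: e {nd le_nk le_k ke} => [|e]; case: d => [|d]; nia.
Qed.

(* The index k stands for the exponent j = k - n, which ranges over [-n, n]. *)
Lemma finite_jacobi (R : idomainType) (q : R) n : q != 0 ->
  \sum_(k < n.*2.+1)
    (-1) ^+ (n + k) * q ^+ (absdiff n k ^ 2) * qbinom (q ^+ 2) n.*2 k
  = (\prod_(i < n) (1 - q ^+ i.*2.+1)) ^+ 2.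
Proof.
move=> q0; set P := \prod_(i < n) _.
(* The signs and monomials extracted below from the 2n factors q^(2n-1) - q^(2i). *)
pose c := (-1) ^+ n * q ^+ (n * n.-1 + n * n.*2.-1).
have c0 : c != 0 by rewrite mulf_neq0 ?signr_eq0 ?expf_neq0.
apply: (mulfI c0).
transitivity (\prod_(i < n.*2) (q ^+ n.*2.-1 + -1 * (q ^+ 2) ^+ i)).
  rewrite rothe mulr_sumr; apply: eq_bigr => -[k /= lt_k] _.
  have -> : (q ^+ 2) ^+ 'C(k, 2) = q ^+ (k * k.-1).
    rewrite -exprM; congr (_ ^+ _); elim: k {lt_k} => // k IHk.
    by rewrite binS bin1 mulnDr IHk; case: k {IHk} => *; nia.
  rewrite -exprM.
  have -> : c * ((-1) ^+ (n + k) * q ^+ (absdiff n k ^ 2)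
                 * qbinom (q ^+ 2) n.*2 k)
    = (-1) ^+ n * (-1) ^+ (n + k)
      * q ^+ (n * n.-1 + n * n.*2.-1 + absdiff n k ^ 2)
      * qbinom (q ^+ 2) n.*2 k.
    by rewrite [q ^+ (_ + _ ^ 2)]exprD /c; ring.
  have -> : (n * n.-1 + n * n.*2.-1 + absdiff n k ^ 2
             = k * k.-1 + n.*2.-1 * (n.*2 - k))%N.
    exact: jacobi_exponent.
  rewrite [q ^+ (_ + _)]exprD exprD mulrA -expr2 sqrr_sign; ring.
have -> : \prod_(i < n.*2) (q ^+ n.*2.-1 + -1 * (q ^+ 2) ^+ i) =
  (\prod_(i < n) (q ^+ n.*2.-1 - (q ^+ 2) ^+ i)) *
  (\prod_(i < n) (q ^+ n.*2.-1 - (q ^+ 2) ^+ (n + i))).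
  rewrite -addnn big_split_ord /=.
  by congr (_ * _); apply: eq_bigr => i _; rewrite mulN1r.
(* Here q^(2i) is the lower power; the cofactors 1 - q^(2(n-1-i)+1) run through [P] backwards. *)
have -> : \prod_(i < n) (q ^+ n.*2.-1 - (q ^+ 2) ^+ i)
        = (-1) ^+ n * q ^+ (n * n.-1) * P.
  rewrite -prod_qeven /P [X in _ = _ * X](reindex_inj rev_ord_inj) /=.
  rewrite -[n in (-1) ^+ n]card_ord -prodr_const -!big_split /=.
  apply: eq_bigr => -[i /= lt_i] _.
  have -> : (q ^+ n.*2.-1 = (q ^+ 2) ^+ i * q ^+ (n - i.+1).*2.+1).
    by rewrite -exprM -exprD; congr (_ ^+ _); lia.
  ring.
have -> : \prod_(i < n) (q ^+ n.*2.-1 - (q ^+ 2) ^+ (n + i))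
        = q ^+ (n * n.*2.-1) * P.
  rewrite mulnC exprM -[n in (q ^+ _) ^+ n]card_ord -prodr_const -big_split /=.
  apply: eq_bigr => -[i /= lt_i] _.
  have -> : (q ^+ 2) ^+ (n + i) = q ^+ n.*2.-1 * q ^+ i.*2.+1.
    by rewrite -exprM -exprD; congr (_ ^+ _); lia.
  ring.
rewrite /c exprD; ring.
Qed.

(** * Gauss's identity modulo a power of q *)

Definition eqmodp (F : fieldType) (d a b : {poly F}) : bool := d %| a - b.

Section Congruence.
Variables (F : fieldType) (d : {poly F}).
Implicit Types a b c e : {poly F}.

Lemma eqmodp_refl a : eqmodp d a a.
Proof. by rewrite /eqmodp subrr dvdp0. Qed.

Lemma eqmodp_sym a b : eqmodp d a b -> eqmodp d b a.
Proof. by rewrite /eqmodp -opprB dvdpNr. Qed.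

Lemma eqmodp_trans b a c : eqmodp d a b -> eqmodp d b c -> eqmodp d a c.
Proof.
by move=> ab bc; rewrite /eqmodp -(subrK b a) -addrA; apply: dvdp_add.
Qed.

Lemma eqmodpM a b c e :
  eqmodp d a b -> eqmodp d c e -> eqmodp d (a * c) (b * e).
Proof.
move=> ab ce; have -> : a * c = (a - b) * c + b * c by ring.
rewrite /eqmodp -addrA -mulrBr; apply: dvdp_add.
  exact: dvdp_mulr.
exact: dvdp_mull.
Qed.

Lemma eqmodpMl a b c : eqmodp d b c -> eqmodp d (a * b) (a * c).
Proof. exact/eqmodpM/eqmodp_refl. Qed.

Lemma eqmodp_sum (I : Type) (r : seq I) (f g : I -> {poly F}) :
  (forall i, eqmodp d (f i) (g i)) ->
  eqmodp d (\sum_(i <- r) f i) (\sum_(i <- r) g i).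
Proof.
move=> fg; elim/big_rec2: _ => [|i a b _ ab]; first exact: eqmodp_refl.
by rewrite /eqmodp opprD addrACA dvdp_add //; apply: fg.
Qed.

Lemma eqmodp_prod (I : eqType) (r : seq I) (f g : I -> {poly F}) :
  {in r, forall i, eqmodp d (f i) (g i)} ->
  eqmodp d (\prod_(i <- r) f i) (\prod_(i <- r) g i).
Proof.
rewrite big_seq [in X in eqmodp _ _ X]big_seq => fg.
elim/big_rec2: _ => [|i a b /fg fgi ab]; first exact: eqmodp_refl.
exact: eqmodpM.
Qed.

Lemma eqmodp_cancel c a b :
  coprimep d c -> eqmodp d (c * a) (c * b) -> eqmodp d a b.
Proof. by move=> dc; rewrite /eqmodp -mulrBr Gauss_dvdpr. Qed.

End Congruence.

Lemma eqmodp_dvd (F : fieldType) (d e a b : {poly F}) :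
  e %| d -> eqmodp d a b -> eqmodp e a b.
Proof. exact: dvdp_trans. Qed.

(** * Truncated q-products and the theta sum *)

Section Gauss.
Variables (F : fieldType) (q : {poly F}).

(** Each factor is 1 minus a multiple of q. Thus [qpoch] can be cancelled modulo powers of q, like a
    power series with constant term 1. *)
Lemma coprimep_qpoch M k n : coprimep (q ^+ M) (qpoch (q ^+ k.+1) n).
Proof.
apply: coprimep_expl; rewrite /qpoch; elim/big_rec: _ => [|i p _ cop].
  exact: coprimep1.
rewrite coprimepMr cop andbT -exprM mulSn addSn exprS mulrC addrC -mulNr.
by rewrite coprimep_addl_mul coprimep1.
Qed.

Lemma qpoch_stable (Q : {poly F}) m n :
  (m <= n)%N -> eqmodp (Q ^+ m.+1) (qpoch Q n) (qpoch Q m).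
Proof.
move=> /subnK <-; elim: (n - m)%N => [|k IHk]; first exact: eqmodp_refl.
rewrite addSn qpochS -[X in eqmodp _ _ X]mulr1; apply: eqmodpM => //.
by rewrite /eqmodp addrC addKr dvdpNr dvdp_exp2l // ltnS leq_addl.
Qed.

(** Modulo Q^(lo+1), where [lo] is the smaller of k and 2n - k, all the [qpoch] factors involved
    agree with [qpoch Q lo], so (Q; Q)_n [2n, k]_Q is 1. The factor q^((n-k)^2) raises the precision
    to q^(2n+1). *)
Lemma qbinom_theta_term n k : (k <= n.*2)%N ->
  eqmodp (q ^+ n.*2.+1)
    (q ^+ (absdiff n k ^ 2) * (qpoch (q ^+ 2) n * qbinom (q ^+ 2) n.*2 k))
    (q ^+ (absdiff n k ^ 2)).
Proof.
move=> le_k; set Q := q ^+ 2; set B := qbinom _ _ _.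
pose lo := (n - absdiff n k)%N; pose hi := (n + absdiff n k)%N.
have BE : B * qpoch Q hi * qpoch Q lo = qpoch Q n.*2.
  have := qbinom_qpoch Q (n.*2 - k) k; rewrite subnK // -/B => <-.
  have [le_kn | lt_nk] := leqP k n.
    have -> : hi = (n.*2 - k)%N by rewrite /hi /absdiff; lia.
    have -> : lo = k by rewrite /lo /absdiff; lia.
    by rewrite mulrAC.
  have -> : lo = (n.*2 - k)%N by rewrite /lo /absdiff; lia.
  by have -> : hi = k by rewrite /hi /absdiff; lia.
have le_dn : (absdiff n k <= n)%N by rewrite /absdiff; lia.
have st m : (lo <= m)%N -> eqmodp (Q ^+ lo.+1) (qpoch Q m) (qpoch Q lo).
  exact: qpoch_stable.
have cong1 : eqmodp (Q ^+ lo.+1) (qpoch Q n * B) 1.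
  apply: (@eqmodp_cancel _ _ (qpoch Q lo)).
    by rewrite /Q -exprM coprimep_qpoch.
  apply: (@eqmodp_trans _ _ (qpoch Q n.*2)); last first.
    by rewrite mulr1 st // /lo; lia.
  rewrite -BE mulrAC.
  rewrite (_ : qpoch Q lo * _ = B * qpoch Q lo * qpoch Q n); last by ring.
  apply: eqmodpMl; apply: (@eqmodp_trans _ _ (qpoch Q lo)).
    by rewrite st // /lo; lia.
  by apply: eqmodp_sym; rewrite st // /lo /hi; lia.
rewrite -[X in eqmodp _ _ X]mulr1 /eqmodp -mulrBr.
apply: (@dvdp_trans _ (q ^+ (absdiff n k ^ 2) * Q ^+ lo.+1)); last first.
  exact: dvdp_mul.
(* With d = |n - k|, d^2 + 2(n - d + 1) = (d - 1)^2 + 2n + 1. *)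
rewrite -exprM -exprD dvdp_exp2l // /lo.
by move: (absdiff n k) le_dn => d le_dn; nia.
Qed.

(** The sum of (-1)^j q^(j^2) over |j| <= n, with j = k - n. *)
Definition theta (n : nat) : {poly F} :=
  \sum_(k < n.*2.+1) (-1) ^+ (n + k) * q ^+ (absdiff n k ^ 2).

Lemma qpoch_odd_even n :
  qpoch (q ^+ 2) n * (\prod_(i < n) (1 - q ^+ i.*2.+1)) = qpoch q n.*2.
Proof.
elim: n => [|n IHn]; first by rewrite /qpoch !big_ord0 mulr1.
rewrite doubleS !qpochS -IHn big_ord_recr /= -exprM mul2n doubleS; ring.
Qed.

Lemma qpoch_sqr n :
  qpoch q n * (\prod_(i < n) (1 + q ^+ i.+1)) = qpoch (q ^+ 2) n.
Proof.
rewrite -big_split; apply: eq_bigr => i _ /=.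
by rewrite -exprM mul2n -addnn exprD; ring.
Qed.

Theorem gauss_theta n : q != 0 ->
  eqmodp (q ^+ n.*2.+1) (theta n * \prod_(i < n.*2) (1 + q ^+ i.+1))
    (qpoch q n.*2).
Proof.
move=> q0; set d := q ^+ _; set E := \prod_(i < _) _.
pose P := \prod_(i < n) (1 - q ^+ i.*2.+1).
have thetaE : eqmodp d (theta n) (qpoch q n.*2 * P).
  rewrite -qpoch_odd_even -mulrA -expr2 -finite_jacobi // mulr_sumr.
  apply: eqmodp_sum => -[k /= lt_k]; apply: eqmodp_sym.
  set B := qbinom _ _ _; set S := (-1) ^+ _; set D := q ^+ (_ ^ 2).
  rewrite (_ : qpoch _ _ * _ = S * (D * (qpoch (q ^+ 2) n * B))); last by ring.
  apply: eqmodpMl.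
  exact: qbinom_theta_term.
(* Euler's identity between odd and distinct parts, truncated: multiplied by (q^2; q^2)_n, the left
   side becomes (q^2; q^2)_(2n). *)
have PE : eqmodp d (P * E) 1.
  apply: (@eqmodp_cancel _ _ (qpoch (q ^+ 2) n)); first exact: coprimep_qpoch.
  rewrite mulrA qpoch_odd_even qpoch_sqr mulr1.
  apply: eqmodp_dvd (qpoch_stable _ _); last by rewrite -addnn leq_addr.
  by rewrite -exprM dvdp_exp2l // mul2n doubleS ltnW.
apply: (@eqmodp_trans _ _ (qpoch q n.*2 * P * E)).
  by apply: eqmodpM => //; apply: eqmodp_refl.
by rewrite -[X in eqmodp _ _ X]mulr1 -mulrA; apply: eqmodpMl.
Qed.

End Gauss.

(** * Generating functions of overpartitions *)

(** Deliberately not reflexive on overlined items, which forbids repeating them. *)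
Definition over_geq : rel (nat * bool) :=
  [rel x y | (y.1 <= x.1)%N && (y.2 ==> (x.1 != y.1))].

Lemma over_geq_trans : transitive over_geq.
Proof.
move=> [y b] [x a] [z c]; rewrite /over_geq /=.
by case: c; case: b => /=; lia.
Qed.

(** By transitivity sortedness concerns all pairs, so it splits into a condition on sizes and one on
    overlines. *)
Lemma sorted_over_geq s :
  sorted over_geq s = sorted geq (unzip1 s) && only_first_overlined s.
Proof.
have geq_trans : transitive geq by move=> ? ? ? /=; lia.
rewrite !sorted_pairwise //; last exact: over_geq_trans.
rewrite pairwise_relI pairwise_map; congr andb.
apply/(pairwiseP (0%N, false))/allP => [ov i | ov i j]; last first.
  rewrite -!topredE /= => lt_i lt_j lt_ij.
  have := ov j; rewrite mem_iota /= add0n => /(_ lt_j).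
  rewrite !(nth_map (0%N, false)) // => /implyP ov_j; apply/implyP => /ov_j.
  apply: contra => /eqP <-; apply/(nthP 0%N); exists i.
    by rewrite size_take size_map lt_j.
  by rewrite nth_take // (nth_map (0%N, false)).
rewrite mem_iota add0n /= => lt_i; apply/implyP => ov_i.
apply/negP => /(nthP 0%N)[j]; rewrite size_take size_map lt_i => lt_ji.
have lt_j := ltn_trans lt_ji lt_i.
rewrite nth_take // !(nth_map (0%N, false)) // in ov_i * => eq_ji.
by have := ov j i lt_j lt_i lt_ji; rewrite /= ov_i eq_ji eqxx.
Qed.

Definition over_gt : rel (nat * bool) :=
  [rel x y | over_geq x y && ~~ over_geq y x].

(** For a positive size, cutting the geometric series at j = N does not affect coefficients up to
    [N]. *)
Definition item_gf (N : nat) (x : nat * bool) : {poly rat} :=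
  if x.2 then 1 + 'X^(x.1) else \sum_(j < N.+1) 'X^(x.1 * j).

Definition fits (xs : seq (nat * bool)) n (s : seq (nat * bool)) : bool :=
  [&& sorted over_geq s, all (mem xs) s & sumn (unzip1 s) == n].

Lemma item_gf_geometric N p :
  (1 - 'X^p) * item_gf N (p, false) = 1 - 'X^(p * N.+1).
Proof.
rewrite /item_gf /=; under eq_bigr do rewrite exprM.
by rewrite -opprB mulNr -subrX1 opprB exprM.
Qed.

(** The recursion on coefficients that parallels [fits_cons]: either [x] is absent, or one copy is
    removed, after which only a plain [x] stays available. *)
Lemma item_gf_coef N x (p : {poly rat}) n : (0 < x.1)%N -> (n <= N)%N ->
  (item_gf N x * p)`_n = p`_n +
    (if (x.1 <= n)%N then (if x.2 then p else item_gf N x * p)`_(n - x.1)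
     else 0).
Proof.
case: x => a [] /= a_gt0 le_nN; rewrite /item_gf /=.
  by rewrite mulrDl mul1r coefD coefXnM ltnNge; case: leqP.
set S := \sum_(j < _) _.
(* The correction X^(a(N+1)) has degree above [N], so it does not reach coefficient [n]. *)
have SE : S = 1 + 'X^a * S - 'X^(a * N.+1).
  by rewrite addrAC -item_gf_geometric /item_gf /= -/S; ring.
rewrite [in LHS]SE mulrBl mulrDl mul1r -mulrA coefB coefD !coefXnM.
have -> : (n < a * N.+1)%N by nia.
by rewrite subr0 ltnNge; case: leqP.
Qed.

Lemma fits_nil n s : fits [::] n s = (n == 0%N) && (s == [::]).
Proof.
by rewrite /fits; case: s => [|x s] /=; rewrite ?andbT ?andbF // eq_sym.
Qed.

(** Since [x] lies strictly above all of [xs], it occurs in a fitting list only if it is the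
    head. *)
Lemma fits_cons x xs n s : (0 < x.1)%N -> all (over_gt x) xs ->
  fits (x :: xs) n s =
  fits xs n s ||
  [&& (x.1 <= n)%N, ohead s == Some x &
     fits (if x.2 then xs else x :: xs) (n - x.1)%N (behead s)].
Proof.
move=> x_gt0 /allP x_gt; rewrite /fits.
case: s => [|y s] /=; first by rewrite !andbF orbF.
rewrite !path_sortedE; try exact: over_geq_trans.
rewrite inE; have [-> | neq_yx] /= := eqVneq y x; last first.
  rewrite (inj_eq Some_inj) (negPf neq_yx) /= andbF orbF.
  have [/= y_xs | _] := boolP (y \in xs); last by rewrite !andbF.
  have [y_geq | //] := boolP (all (over_geq y) s).
  rewrite /=; congr [&& _, _ & _]; apply/eq_in_all => z z_s /=.
  rewrite inE; case: eqVneq => // zx; move: (x_gt _ y_xs) => /andP[_].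
  by rewrite -zx (allP y_geq).
have x_xs : x \in xs = false.
  by apply/negP => /x_gt /andP[xx]; rewrite xx.
rewrite x_xs !andbF /= eqxx /=.
have -> : (x.1 + sumn (unzip1 s) == n) =
          (x.1 <= n)%N && (sumn (unzip1 s) == (n - x.1)%N).
  by apply/eqP/andP => [<-|[? /eqP->]]; [rewrite leq_addr addKn | lia].
case: (x.1 <= n)%N; last by rewrite !andbF.
case: (_ == _); last by rewrite !andbF.
rewrite !andbT /=; case: (sorted over_geq s); last by rewrite !andbF.
rewrite andbT /=; apply/andP/idP => [[/allP x_geq /allP s_xs]|].
  case: ifP => x2; apply/allP => z z_s /=; last exact: s_xs.
  have := s_xs _ z_s; rewrite inE => /orP[/eqP zx | //].
  by have := x_geq _ z_s; rewrite zx /over_geq /= x2 eqxx /= andbF.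
have x_geq z : z \in xs -> over_geq x z by move=> /x_gt /andP[].
case: ifP => x2 /allP s_xs; split; apply/allP => z /s_xs /=; rewrite ?inE.
- exact: x_geq.
- by move=> ->; rewrite orbT.
- by case/orP => [/eqP-> | /x_geq //]; rewrite /over_geq /= x2 leqnn.
- by [].
Qed.

(** Induction on [size xs + n]: dropping [x] lowers the first summand, using it lowers the second
    because its size is positive. *)
Lemma fits_gf N xs n : pairwise over_gt xs -> all (fun x => 0 < x.1)%N xs ->
  (n <= N)%N ->
  exists2 l : seq (seq (nat * bool)),
    uniq l /\ (forall s, (s \in l) = fits xs n s) &
    (size l)%:R = (\prod_(x <- xs) item_gf N x)`_n.
Proof.
have [k] := ubnP (size xs + n); elim: k xs n => // k IHk [|x xs] n le_k.
  move=> _ _ _; exists (if n == 0%N then [:: [::]] else [::]).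
    by split=> [|s]; rewrite ?fits_nil; case: eqP => //; rewrite inE.
  by rewrite big_nil coef1; case: eqP.
rewrite [pairwise _ _]/= [all _ _]/= => /andP[x_gt pw_xs].
move=> /andP[x_gt0 xs_gt0] le_nN.
have [/= | l1 [uniq1 mem1] size1] := IHk xs n _ pw_xs xs_gt0 le_nN.
  by move: le_k => /=; lia.
rewrite big_cons item_gf_coef // -size1.
have mem_x s : s \in l1 -> x \notin s.
  rewrite mem1 => /and3P[_ /allP s_xs _].
  by apply/negP => /s_xs /(allP x_gt) /andP[xx]; rewrite xx.
have [le_xn | lt_nx] := leqP x.1 n; last first.
  exists l1; last by rewrite addr0.
  by split=> // s; rewrite fits_cons // leqNgt lt_nx orbF mem1.
pose ys := if x.2 then xs else x :: xs.
have [] := IHk ys (n - x.1)%N; rewrite /ys.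
- by move: le_k; case: ifP => /= _; lia.
- by case: ifP => //= _; rewrite x_gt.
- by case: ifP => //= _; rewrite x_gt0.
- by rewrite (leq_trans (leq_subr _ _)).
rewrite -/ys => l2 [uniq2 mem2] size2.
exists (l1 ++ map (cons x) l2); last first.
  rewrite size_cat size_map natrD size2 /ys.
  by case: ifP => // _; rewrite big_cons.
split=> [|s].
  rewrite cat_uniq uniq1 map_inj_uniq ?uniq2 ?andbT; last by move=> ? ? [].
  apply/hasPn => _ /mapP[s _ ->]; apply/negP => /mem_x.
  by rewrite inE eqxx.
rewrite fits_cons // mem_cat mem1 le_xn /=; congr orb.
case: s => [|y s] /=; first by apply/negP => /mapP[].
rewrite (inj_eq Some_inj); have [-> | neq_yx] /= := eqVneq y x.
  by rewrite mem_map ?mem2 // => ? ? [].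
by apply/negP => /mapP[t _ [/eqP]]; rewrite (negPf neq_yx).
Qed.

(** * From lists of items to overpartitions *)

Lemma card_bounded_parts n (P : pred (seq (nat * bool))) l :
  (forall s, P s -> is_overpartition n s) ->
  uniq l -> (forall s, (s \in l) = P s) ->
  #|[set t : bounded_parts n | P (parts t)]| = size l.
Proof.
move=> P_over uniq_l mem_l; rewrite cardE -(size_map (@parts n)).
apply: perm_size; apply: uniq_perm => //.
  by rewrite map_inj_uniq ?enum_uniq //; apply: parts_inj.
move=> s; rewrite mem_l; apply/mapP/idP => [[t] | Ps].
  by rewrite mem_enum inE => Pt ->.
have [t ts] := overpartition_bounded (P_over _ Ps).
by exists t; rewrite // mem_enum inE ts.
Qed.

(** The overlined copy comes first, so decreasing sizes give items decreasing for [over_gt]. *)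
Definition items (ps : seq nat) : seq (nat * bool) :=
  [seq (p, b) | p <- ps, b <- [:: true; false]].

Lemma mem_items ps x : (x \in items ps) = (x.1 \in ps).
Proof.
apply/allpairsP/idP => [[[p b] /= [p_ps _ ->]] // | x_ps].
by exists x; case: x x_ps => p [].
Qed.

Lemma items_pairwise ps : pairwise gtn ps -> pairwise over_gt (items ps).
Proof.
elim: ps => //= p ps IHps /andP[/allP p_gt /IHps ->]; rewrite andbT.
have gt b : all (over_gt (p, b)) (items ps).
  apply/allP => -[r c]; rewrite mem_items => /p_gt.
  by rewrite /over_gt /over_geq /=; case: b; case: c => /=; lia.
by rewrite -/(items ps) !gt /over_gt /over_geq /= leqnn eqxx.
Qed.

Definition over_gf N p : {poly rat} :=
  item_gf N (p, true) * item_gf N (p, false).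

Lemma prod_items N ps :
  \prod_(x <- items ps) item_gf N x = \prod_(p <- ps) over_gf N p.
Proof.
elim: ps => [|p ps IHps]; first by rewrite !big_nil.
by rewrite /items /= !big_cons IHps mulrA.
Qed.

(** Applied with [predT] and [odd]. As [N] is independent of [n], one product serves all
    coefficients up to [N]. *)
Lemma over_count N n (a : pred nat) : (n <= N)%N ->
  #|[set t : bounded_parts n |
      is_overpartition n (parts t) && all a (unzip1 (parts t))]|%:R
  = (\prod_(1 <= p < N.+1 | a p) over_gf N p)`_n :> rat.
Proof.
move=> le_nN; pose ps := rev [seq p <- index_iota 1 N.+1 | a p].
have [] := @fits_gf N (items ps) n.
- apply: items_pairwise; rewrite -sorted_pairwise; last by move=> ? ? ? /=; lia.
  rewrite /ps rev_sorted.
  apply: sorted_filter => [? ? ?|]; first exact: ltn_trans.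
  exact: iota_ltn_sorted.
- apply/allP => x; rewrite mem_items mem_rev mem_filter mem_index_iota.
  by case/and3P.
- exact: le_nN.
move=> l [uniq_l mem_l]; rewrite prod_items /ps big_rev big_filter => <-.
pose P s := is_overpartition n s && all a (unzip1 s).
congr (_%:R); apply: (@card_bounded_parts n P) => //.
  by move=> s /andP[].
move=> s; rewrite mem_l /fits sorted_over_geq /P.
rewrite /is_overpartition /is_partition.
case: (sorted geq _) => //=.
case: (only_first_overlined s); last by rewrite !andbF.
rewrite andbT /=; case: eqP => [sum_s | _]; last by rewrite !andbF.
rewrite !andbT !all_map -all_predI.
apply/eq_in_all => x x_s /=.
rewrite mem_items mem_rev mem_filter mem_index_iota andbC.
congr andb; rewrite andbC ltnS.
suff -> : (x.1 <= N)%N by [].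
apply: leq_trans le_nN; rewrite -sum_s sumnE (big_rem x.1) ?leq_addr //.
exact: map_f.
Qed.

Lemma over_gfE N p : (0 < p)%N ->
  eqmodp 'X^(N.+1) ((1 - 'X^p) * over_gf N p) (1 + 'X^p).
Proof.
move=> p_gt0; rewrite /over_gf mulrCA item_gf_geometric.
rewrite -[X in eqmodp _ _ X]mulr1; apply: eqmodpMl.
rewrite /eqmodp addrC addKr dvdpNr dvdp_exp2l //.
exact: leq_pmull.
Qed.

(** * Gauss's identity at q = X^2 and comparison of coefficients *)

Lemma prod_even (R : comNzRingType) (f : nat -> R) m :
  \prod_(1 <= p < m.*2.+1 | ~~ odd p) f p = \prod_(i < m) f i.+1.*2.
Proof.
elim: m => [|m IHm]; first by rewrite big_ord0 big_geq.
rewrite big_ord_recr -IHm [in LHS]big_mkcond doubleS /=.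
by rewrite big_nat_recr //= big_nat_recr //= -big_mkcond /= odd_double mulr1.
Qed.

(** Odd sizes contribute equally to both sides. Even sizes 2i with i <= 2n give the inverse of
    [theta] by [gauss_theta] at q = X^2, whence the cutoff 4n. *)
Lemma theta_over_gf n :
  eqmodp 'X^(n.*2.*2.+1)
    (theta 'X^2 n * \prod_(1 <= p < n.*2.*2.+1) over_gf n.*2.*2 p)
    (\prod_(1 <= p < n.*2.*2.+1 | odd p) over_gf n.*2.*2 p).
Proof.
rewrite (bigID odd) /= prod_even mulrCA -[X in eqmodp _ _ X]mulr1.
apply: eqmodpMl; set d := 'X^_; set A := \prod_(i < _) _.
have d_dvd : d %| ('X^2 : {poly rat}) ^+ n.*2.+1.
  by rewrite -exprM dvdp_exp2l // mul2n doubleS ltnW.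
apply: (@eqmodp_cancel _ _ (qpoch 'X^2 n.*2)).
  exact: (coprimep_qpoch 'X _ 1 _).
rewrite mulr1 mulrCA.
apply: eqmodp_trans (eqmodp_dvd d_dvd (gauss_theta _ _)); last first.
  by rewrite expf_neq0 // polyX_eq0.
apply: eqmodpMl; rewrite /qpoch /A -big_split /=.
apply: eqmodp_prod => i _; rewrite -exprM mul2n; exact: over_gfE.
Qed.

Lemma eqmodp_coef (F : fieldType) M i (a b : {poly F}) :
  (i < M)%N -> eqmodp 'X^M a b -> a`_i = b`_i.
Proof.
move=> lt_iM /dvdpP[c abE]; rewrite -(subrK b a) abE coefD coefMXn lt_iM.
by rewrite add0r.
Qed.

Lemma overpE N n : (n <= N)%N ->
  (overp n)%:R = (\prod_(1 <= p < N.+1) over_gf N p)`_n.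
Proof.
move=> le_nN; rewrite -(over_count predT le_nN) /overp.
by congr (_%:R); apply: eq_card => t; rewrite !inE all_predT andbT.
Qed.

Lemma signz_dist n k : (-1) ^ (k%:Z - n%:Z) = (-1) ^+ (n + k) :> int.
Proof.
rewrite exprzDr ?unitrN1 // -exprnP exprD mulrC; congr (_ * _).
by rewrite -exprnN -exprVn invrN1.
Qed.

Lemma overpz_dist n k :
  overpz (n%:Z - 2 * (k%:Z - n%:Z) ^+ 2) =
  if (2 * absdiff n k ^ 2 <= n)%N then overp (n - 2 * absdiff n k ^ 2)%N
  else 0%N.
Proof.
have -> : (k%:Z - n%:Z) ^+ 2 = (absdiff n k ^ 2)%N%:Z.
  by rewrite /absdiff; case: (leqP k n) => ?; nia.
case: leqP => [le_dn | lt_nd].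
  suff -> : n%:Z - 2 * (absdiff n k ^ 2)%N%:Z = (n - 2 * absdiff n k ^ 2)%N%:Z.
    by [].
  by lia.
have : n%:Z - 2 * (absdiff n k ^ 2)%N%:Z < 0 by lia.
by case: (_ - _).
Qed.

Theorem theorem3p5 (n : nat) :
  (overp_odd n)%:Z =
    \sum_(k \in (setT : set int)) (-1) ^ k * (overpz (n%:Z - 2 * k ^+ 2))%:Z.
Proof.
have le_n4 : (n <= n.*2.*2)%N by lia.
(* For |k| > n the argument n - 2k^2 is negative, so the integers from -n to n cover the support. *)
rewrite (fsbigE [seq k%:Z - n%:Z | k <- iota 0 n.*2.+1]) //; first last.
- move=> k _ k_out; suff : n%:Z - 2 * k ^+ 2 < 0.
    by case: (_ - _) => // *; rewrite mulr0.
  rewrite ltNge; apply: contra k_out => le_kn.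
  apply/mapP; exists (absz (k + n%:Z)); last nia.
  by rewrite mem_iota /=; nia.
- by rewrite map_inj_uniq ?iota_uniq // => i j /addIr [].
apply: (@intr_inj rat); rewrite -pmulrn /overp_odd (over_count odd le_n4).
rewrite -(eqmodp_coef _ (theta_over_gf n)); last by rewrite ltnS.
rewrite mulr_suml coef_sum big_map -[iota _ _]/(index_iota 0 n.*2.+1).
rewrite big_mkord rmorph_sum /=.
apply: eq_big => k; [by rewrite in_setT | move=> _].
rewrite signz_dist overpz_dist.
rewrite intrM rmorphXn rmorphN rmorph1 -pmulrn.
rewrite -mulrA -(rmorph_sign polyC) coefCM.
(* Multiplication by X^(2d^2), with d = |n - k|, shifts coefficients and gives 0 below that degree,
   matching [overpz] at negative arguments. *)
congr (_ * _); rewrite -exprM coefXnM ltnNge; case: leqP => //= _.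
by rewrite -(@overpE n.*2.*2) // (leq_trans (leq_subr _ _)).
Qed.
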